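(* Let $R$ be a $\phi$-ring. Then the following statements are equivalent: (1) $R$ is a $\phi$-Prüfer ring and a strongly $\phi$-ring. (2) $\phi\text{-}w.gl.\dim(R) \leq 1$. (3) $R$ is a nonnil-semihereditary ring.
   Context: All rings are commutative with nonzero identity. For a ring $R$, $\mathrm{Nil}(R)$ denotes the ideal of nilpotent elements, $Z(R)$ the set of zerodivisors and $T(R)$ the total quotient ring. A prime ideal $P$ of $R$ is called divided if it is comparable (under inclusion) to every ideal of $R$. $R$ is a $\phi$-ring if $\mathrm{Nil}(R)$ is a divided prime ideal of $R$; a $\phi$-ring $R$ is a strongly $\phi$-ring (strong $\phi$-ring) if $Z(R) = \mathrm{Nil}(R)$. An ideal $I$ of $R$ is nonnil if $I \not\subseteq \mathrm{Nil}(R)$. For a $\phi$-ring $R$, let $\phi: T(R) \to R_{\mathrm{Nil}(R)}$ be the ring homomorphism $\phi(a/b) = a/b$ for $a\in R$, $b \in R\setminus Z(R)$; restricted to $R$ it is the ring homomorphism $x \mapsto x/1$, with image the ring $\phi(R)$. A nonnil ideal $I$ of a $\phi$-ring $R$ is $\phi$-invertible if $\phi(I)$ is an invertible ideal of $\phi(R)$, i.e. $\phi(I)\,\phi(I)^{-1} = \phi(R)$ where $\phi(I)^{-1} = \{x \in T(\phi(R)) : x\phi(I) \subseteq \phi(R)\}$. A $\phi$-ring $R$ is $\phi$-Prüfer if every finitely generated nonnil ideal of $R$ is $\phi$-invertible. The $\phi$-weak global dimension of a $\phi$-ring $R$ is $\phi\text{-}w.gl.\dim(R) = \sup\{\mathrm{fd}_R(R/I)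 : I \text{ is a nonnil ideal of } R\}$ (equivalently, the supremum over finitely generated nonnil ideals $I$), where $\mathrm{fd}_R$ denotes flat dimension. $R$ is nonnil-semihereditary if every finitely generated nonnil ideal of $R$ is projective. *)

(* Defs.v *)
From HB Require Import structures.
From mathcomp Require Import all_boot all_order all_algebra.
From mathcomp Require Import boolp classical_sets.
From mathcomp Require Import ring.

Set Implicit Arguments.
Unset Strict Implicit.
Unset Printing Implicit Defensive.

Import GRing.Theory.

Local Open Scope ring_scope.
Local Open Scope quotient_scope.
Local Open Scope classical_set_scope.

(* Ideals are the submodules of the regular module. They may be improper, in
   contrast with MathComp's [idealr]. Membership is boolean, which is no
   restriction classically. *)
Notation ideal A := (submodClosed A^o).

Section Submodule.
Variables (A : pzRingType) (V : lmodType A) (N : submodClosed V).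

Definition submodule := {x : V | x \in N}.

HB.instance Definition _ := SubChoice.on submodule.
HB.instance Definition _ :=
  GRing.SubChoice_isSubLmodule.Build A V (mem N) submodule (GRing.subsemimodClosedP N).

End Submodule.

Section QuotientModule.
Variables (A : pzRingType) (V : lmodType A) (N : submodClosed V).

Let rpredNN (x : V) : x \in N -> - x \in N.
Proof. by move=> Nx; rewrite -scaleN1r rpredZ. Qed.

Definition modeq : rel V := fun x y => x - y \in N.

Fact modeq_equiv : equiv_class_of modeq.
Proof.
split=> [x|x y|y x z]; rewrite /modeq.
- by rewrite subrr rpred0.
- by apply/idP/idP => /rpredNN; rewrite opprB.
- by move=> xy yz; rewrite -[x](subrK y) -addrA rpredD.
Qed.

Canonical modeq_equiv_rel := EquivRelPack modeq_equiv.

Definition quotmod := {eq_quot modeq}.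
HB.instance Definition _ := Choice.on quotmod.

Definition quotmod_pi (x : V) : quotmod := \pi_{eq_quot modeq} x.

Lemma quotmod_piP (x y : V) : quotmod_pi x = quotmod_pi y <-> x - y \in N.
Proof. by split=> [/eqmodP|xy]; last exact/eqmodP. Qed.

Lemma quotmod_reprK (x : quotmod) :
  quotmod_pi (repr (x : {eq_quot modeq})) = x.
Proof. exact: reprK. Qed.

Let rp (x : quotmod) : V := repr (x : {eq_quot modeq}).
Let rpP x : rp (quotmod_pi x) - x \in N.
Proof. by apply/quotmod_piP; exact: quotmod_reprK. Qed.

Definition quotmod_zero : quotmod := quotmod_pi 0.
Definition quotmod_opp (x : quotmod) := quotmod_pi (- rp x).
Definition quotmod_add (x y : quotmod) := quotmod_pi (rp x + rp y).
Definition quotmod_scale a (x : quotmod) := quotmod_pi (a *: rp x).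

Let piN x : quotmod_opp (quotmod_pi x) = quotmod_pi (- x).
Proof. by apply/quotmod_piP; rewrite -opprD rpredNN. Qed.
Let piD x y :
  quotmod_add (quotmod_pi x) (quotmod_pi y) = quotmod_pi (x + y).
Proof. by apply/quotmod_piP; rewrite opprD addrACA rpredD. Qed.
Let piZ a x : quotmod_scale a (quotmod_pi x) = quotmod_pi (a *: x).
Proof. by apply/quotmod_piP; rewrite -scalerBr rpredZ. Qed.

Let quotmodP (x : quotmod) : exists v, x = quotmod_pi v.
Proof. by exists (rp x); rewrite quotmod_reprK. Qed.

Fact quotmod_addA : associative quotmod_add.
Proof.
move=> x y z; have [[[u ->] [v ->]] [w ->]] := (quotmodP x, quotmodP y, quotmodP z).
by rewrite !piD addrA.
Qed.
Fact quotmod_addC : commutative quotmod_add.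
Proof. by move=> x y; rewrite /quotmod_add addrC. Qed.
Fact quotmod_add0 : left_id quotmod_zero quotmod_add.
Proof. by move=> x; have [u ->] := quotmodP x; rewrite piD add0r. Qed.
Fact quotmod_addN : left_inverse quotmod_zero quotmod_opp quotmod_add.
Proof. by move=> x; have [u ->] := quotmodP x; rewrite piN piD addNr. Qed.

HB.instance Definition _ := GRing.isZmodule.Build quotmod
  quotmod_addA quotmod_addC quotmod_add0 quotmod_addN.

Fact quotmod_scaleA a b x :
  quotmod_scale a (quotmod_scale b x) = quotmod_scale (a * b) x.
Proof. by have [u ->] := quotmodP x; rewrite !piZ scalerA. Qed.
Fact quotmod_scale1 : left_id 1 quotmod_scale.
Proof. by move=> x; have [u ->] := quotmodP x; rewrite piZ scale1r. Qed.
Fact quotmod_scaleDr : right_distributive quotmod_scale +%R.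
Proof.
move=> a x y; have [[u ->] [v ->]] := (quotmodP x, quotmodP y).
by rewrite [_ + _]piD !piZ [RHS]piD scalerDr.
Qed.
Fact quotmod_scaleDl x : {morph quotmod_scale^~ x : a b / a + b}.
Proof.
by move=> a b; have [u ->] := quotmodP x; rewrite !piZ [RHS]piD scalerDl.
Qed.

HB.instance Definition _ := GRing.Zmodule_isLmodule.Build A quotmod
  quotmod_scaleA quotmod_scale1 quotmod_scaleDr quotmod_scaleDl.

End QuotientModule.

(* M (x)_A N is the quotient of the finite formal sums of pairs (m, n), under
   concatenation, by the congruence that makes (m, n) bilinear. *)
Section Tensor.
Variables (A : comPzRingType) (M N : lmodType A).

Inductive tens_rel : seq (M * N) -> seq (M * N) -> Prop :=
| TensRefl s : tens_rel s s
| TensSym s t : tens_rel s t -> tens_rel t s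
| TensTrans s t u : tens_rel s t -> tens_rel t u -> tens_rel s u
| TensCat s s' t t' :
    tens_rel s s' -> tens_rel t t' -> tens_rel (s ++ t) (s' ++ t')
| TensC s t : tens_rel (s ++ t) (t ++ s)
| Tens0 n : tens_rel [:: (0, n)] [::]
| TensDl m m' n : tens_rel [:: (m + m', n)] [:: (m, n); (m', n)]
| TensDr m n n' : tens_rel [:: (m, n + n')] [:: (m, n); (m, n')]
| TensZ a m n : tens_rel [:: (a *: m, n)] [:: (m, a *: n)].

Definition tens_relb : rel (seq (M * N)) := fun s t => `[< tens_rel s t >].

Fact tens_equiv : equiv_class_of tens_relb.
Proof.
split=> [s|s t|t s u]; first by apply/asboolP/TensRefl.
- by apply/asboolP/asboolP; exact: TensSym.
- by move=> /asboolP st /asboolP tu; apply/asboolP; exact: TensTrans tu.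
Qed.

Canonical tens_equiv_rel := EquivRelPack tens_equiv.

Definition tensor := {eq_quot tens_relb}.
HB.instance Definition _ := Choice.on tensor.

Definition tens_pi (s : seq (M * N)) : tensor := \pi_{eq_quot tens_relb} s.

Definition tens_repr (x : tensor) : seq (M * N) :=
  repr (x : {eq_quot tens_relb}).

Lemma tens_piP s t : tens_pi s = tens_pi t <-> tens_rel s t.
Proof. by split=> [/eqmodP/asboolP|st]; last by apply/eqmodP/asboolP. Qed.

Lemma tens_reprK : cancel tens_repr tens_pi.
Proof. by move=> x; exact: reprK. Qed.

Definition tens_add (x y : tensor) := tens_pi (tens_repr x ++ tens_repr y).
Definition tens_scale a (x : tensor) :=
  tens_pi [seq (a *: p.1, p.2) | p <- tens_repr x].
Definition tens_opp := tens_scale (-1).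

Lemma tens_add_pi s t : tens_add (tens_pi s) (tens_pi t) = tens_pi (s ++ t).
Proof. by apply/tens_piP/TensCat; apply/tens_piP; rewrite tens_reprK. Qed.

Lemma tens_rel_scale a s t : tens_rel s t ->
  tens_rel [seq (a *: p.1, p.2) | p <- s] [seq (a *: p.1, p.2) | p <- t].
Proof.
elim=> {s t} [s|s t _|s t u _ st _ tu|s s' t t' _ ss _ tt|s t|n|m m' n|m n n'|b m n].
- exact: TensRefl.
- exact: TensSym.
- exact: TensTrans tu.
- by rewrite !map_cat; exact: TensCat.
- by rewrite !map_cat; exact: TensC.
- by rewrite /= scaler0; exact: Tens0.
- by rewrite /= scalerDr; exact: TensDl.
- exact: TensDr.
- by rewrite /= scalerA mulrC -scalerA; exact: TensZ.
Qed.

Lemma tens_scale_pi a s :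
  tens_scale a (tens_pi s) = tens_pi [seq (a *: p.1, p.2) | p <- s].
Proof.
by apply/tens_piP/tens_rel_scale/tens_piP; rewrite tens_reprK.
Qed.

Let tensP (x : tensor) : exists s, x = tens_pi s.
Proof. by exists (tens_repr x); rewrite tens_reprK. Qed.

Fact tens_addA : associative tens_add.
Proof.
move=> x y z; have [[[s ->] [t ->]] [u ->]] := (tensP x, tensP y, tensP z).
by rewrite !tens_add_pi catA.
Qed.
Fact tens_addC : commutative tens_add.
Proof. by move=> x y; apply/tens_piP/TensC. Qed.
Fact tens_add0 : left_id (tens_pi [::]) tens_add.
Proof. by move=> x; have [s ->] := tensP x; rewrite tens_add_pi. Qed.

Let tens_relDl a b s :
  tens_rel [seq ((a + b) *: p.1, p.2) | p <- s]
    ([seq (a *: p.1, p.2) | p <- s] ++ [seq (b *: p.1, p.2) | p <- s]).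
Proof.
elim: s => [|[m n] s IHs] /=; first exact: TensRefl.
rewrite scalerDl; apply: TensTrans (TensCat (TensDl _ _ _) IHs) _.
apply: (@TensCat [:: _] [:: _]); first exact: TensRefl.
rewrite -cat1s catA -[X in tens_rel _ (_ ++ X)]cat1s catA.
by apply: TensCat; [exact: TensC | exact: TensRefl].
Qed.

Fact tens_scaleDl x : {morph tens_scale^~ x : a b / a + b >-> tens_add a b}.
Proof.
move=> a b /=; have [s ->] := tensP x; rewrite !tens_scale_pi tens_add_pi.
exact/tens_piP/tens_relDl.
Qed.
Fact tens_scale1 : left_id 1 tens_scale.
Proof.
move=> x; have [s ->] := tensP x; rewrite tens_scale_pi.
by congr tens_pi; elim: s => //= -[m n] s ->; rewrite scale1r.
Qed.
Fact tens_scale0 x : tens_scale 0 x = tens_pi [::].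
Proof.
have [s ->] := tensP x; rewrite tens_scale_pi; apply/tens_piP.
elim: s => [|[m n] s IHs] /=; first exact: TensRefl.
by rewrite scale0r; apply: (@TensCat [:: _] [::] _ [::]) => //; exact: Tens0.
Qed.
Fact tens_addN : left_inverse (tens_pi [::]) tens_opp tens_add.
Proof.
move=> x; rewrite -[X in tens_add _ X]tens_scale1 -tens_scaleDl addNr.
exact: tens_scale0.
Qed.

HB.instance Definition _ := GRing.isZmodule.Build tensor
  tens_addA tens_addC tens_add0 tens_addN.

Fact tens_scaleA a b x : tens_scale a (tens_scale b x) = tens_scale (a * b) x.
Proof.
have [s ->] := tensP x; rewrite !tens_scale_pi -map_comp.
by congr tens_pi; apply: eq_map => p /=; rewrite scalerA.
Qed.
Fact tens_scaleDr : right_distributive tens_scale +%R.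
Proof.
move=> a x y; have [[s ->] [t ->]] := (tensP x, tensP y).
by rewrite [_ + _]tens_add_pi !tens_scale_pi [RHS]tens_add_pi map_cat.
Qed.

HB.instance Definition _ := GRing.Zmodule_isLmodule.Build A tensor
  tens_scaleA tens_scale1 tens_scaleDr tens_scaleDl.

End Tensor.

Definition tensor_map (A : comPzRingType) (M N N' : lmodType A)
    (f : {linear N -> N'}) (x : tensor M N) : tensor M N' :=
  tens_pi [seq (p.1, f p.2) | p <- tens_repr x].

Lemma tensor_map_pi (A : comPzRingType) (M N N' : lmodType A)
    (f : {linear N -> N'}) (s : seq (M * N)) :
  tensor_map f (tens_pi s) = tens_pi [seq (p.1, f p.2) | p <- s].
Proof.
apply/tens_piP; have : tens_rel (tens_repr (tens_pi s)) s.
  by apply/tens_piP; rewrite tens_reprK.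
move: (tens_repr _) => t; elim=> {s t}
  [s|s t _|s t u _ st _ tu|s s' t t' _ ss _ tt|s t|n|m m' n|m n n'|b m n] /=.
- exact: TensRefl.
- exact: TensSym.
- exact: TensTrans tu.
- by rewrite !map_cat; exact: TensCat.
- by rewrite !map_cat; exact: TensC.
- exact: Tens0.
- exact: TensDl.
- by rewrite raddfD; exact: TensDr.
- by rewrite linearZ; exact: TensZ.
Qed.

Definition flat (A : comPzRingType) (M : lmodType A) : Prop :=
  forall (N N' : lmodType A) (f : {linear N -> N'}),
    injective f -> injective (tensor_map (M := M) f).

Definition projective (A : pzRingType) (P : lmodType A) : Prop :=
  forall (M N : lmodType A) (g : {linear M -> N}) (f : {linear P -> N}),
    (forall y : N, exists x : M, g x = y) ->
    exists h : {linear P -> M}, forall x : P, g (h x) = f x.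

(* [None] stands for infinity. *)
Definition enat := option nat.

Definition enat_le (x y : enat) : Prop :=
  match x, y with
  | _, None => True
  | Some m, Some n => (m <= n)%N
  | None, Some _ => False
  end.

Definition enat_least (P : nat -> Prop) : enat :=
  match pselect (exists n, `[< P n >]) with
  | left ex => Some (ex_minn ex)
  | right _ => None
  end.

Definition enat_sup (E : set enat) : enat :=
  enat_least (fun n => forall e : enat, E e -> enat_le e (Some n)).

Definition flat_resolution_length (A : comPzRingType) (M : lmodType A)
    (n : nat) : Prop :=
  exists (F : nat -> lmodType A) (d : forall i, {linear F i.+1 -> F i})
         (eps : {linear F 0%N -> M}),
    [/\ forall i, flat (F i),
        forall i, (n < i)%N -> forall x : F i, x = 0,
        forall y : M, exists x, eps x = y,
        forall x, eps x = 0 <-> exists y, d 0%N y = x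
      & forall i x, d i x = 0 <-> exists y, d i.+1 y = x].

Definition flat_dim (A : comPzRingType) (M : lmodType A) : enat :=
  enat_least (flat_resolution_length M).

Section Localization.
Variables (A : comPzRingType) (S : mulrClosed A).

Definition fracpair := (A * {s : A | s \in S})%type.

Definition fracpair_rel (x y : fracpair) : Prop :=
  exists2 u : A, u \in S & u * (x.1 * sval y.2 - y.1 * sval x.2) = 0.

Definition fracpair_relb : rel fracpair := fun x y => `[< fracpair_rel x y >].

Fact fracpair_equiv : equiv_class_of fracpair_relb.
Proof.
have relC x y : fracpair_rel x y -> fracpair_rel y x.
  by move=> [u Su e]; exists u => //; rewrite -opprB mulrN e oppr0.
split=> [x|x y|y x z].
- by apply/asboolP; exists 1; rewrite ?rpred1 // subrr mulr0.
- by apply/asboolP/asboolP; exact: relC.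
case: x y z => [a [s Ss]] [b [t St]] [c [r Sr]].
move=> /asboolP[u Su /= e] /asboolP[v Sv /= e'].
apply/asboolP; exists (u * v * t); first by rewrite !rpredM.
rewrite /= (_ : _ * _ = v * r * (u * (a * t - b * s))
                        + u * s * (v * (b * r - c * t))); last by ring.
by rewrite e e' !mulr0 addr0.
Qed.

Canonical fracpair_equiv_rel := EquivRelPack fracpair_equiv.

Definition localization := {eq_quot fracpair_relb}.
HB.instance Definition _ := Choice.on localization.

Definition loc_pi (x : fracpair) : localization := \pi_{eq_quot fracpair_relb} x.

Definition loc_repr (x : localization) : fracpair :=
  repr (x : {eq_quot fracpair_relb}).

Lemma loc_piP x y : loc_pi x = loc_pi y <-> fracpair_rel x y.
Proof. by split=> [/eqmodP/asboolP|xy]; last by apply/eqmodP/asboolP. Qed.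

Lemma loc_reprK : cancel loc_repr loc_pi.
Proof. by move=> x; exact: reprK. Qed.

Let den1 : {s : A | s \in S} := exist _ 1 (rpred1 S).
Let denM (s t : {s : A | s \in S}) : {s : A | s \in S} :=
  exist _ (sval s * sval t) (rpredM (svalP s) (svalP t)).

Definition loc_in (a : A) : localization := loc_pi (a, den1).

Definition loc_add (x y : localization) : localization :=
  let: (a, s) := loc_repr x in let: (b, t) := loc_repr y in
  loc_pi (a * sval t + b * sval s, denM s t).
Definition loc_opp (x : localization) : localization :=
  let: (a, s) := loc_repr x in loc_pi (- a, s).
Definition loc_mul (x y : localization) : localization :=
  let: (a, s) := loc_repr x in let: (b, t) := loc_repr y in
  loc_pi (a * b, denM s t).

Let reprP x : fracpair_rel (loc_repr (loc_pi x)) x.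
Proof. by apply/loc_piP; rewrite loc_reprK. Qed.

Lemma loc_add_pi a s b t : loc_add (loc_pi (a, s)) (loc_pi (b, t)) =
  loc_pi (a * sval t + b * sval s, denM s t).
Proof.
rewrite /loc_add.
case: (loc_repr _) (reprP (a, s)) => [a' s'] [u Su /= e].
case: (loc_repr _) (reprP (b, t)) => [b' t'] [v Sv /= e'].
apply/loc_piP; exists (u * v); rewrite ?rpredM //=.
rewrite (_ : _ * _ =
  v * (sval t * sval t') * (u * (a' * sval s - a * sval s')) +
  u * (sval s * sval s') * (v * (b' * sval t - b * sval t'))); last by ring.
by rewrite e e' !mulr0 addr0.
Qed.

Lemma loc_opp_pi a s : loc_opp (loc_pi (a, s)) = loc_pi (- a, s).
Proof.
rewrite /loc_opp; case: (loc_repr _) (reprP (a, s)) => [a' s'] [u Su /= e].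
apply/loc_piP; exists u => //=.
rewrite (_ : _ * _ = - (u * (a' * sval s - a * sval s'))); last by ring.
by rewrite e oppr0.
Qed.

Lemma loc_mul_pi a s b t : loc_mul (loc_pi (a, s)) (loc_pi (b, t)) =
  loc_pi (a * b, denM s t).
Proof.
rewrite /loc_mul.
case: (loc_repr _) (reprP (a, s)) => [a' s'] [u Su /= e].
case: (loc_repr _) (reprP (b, t)) => [b' t'] [v Sv /= e'].
apply/loc_piP; exists (u * v); rewrite ?rpredM //=.
rewrite (_ : _ * _ =
  v * (b' * sval t) * (u * (a' * sval s - a * sval s')) +
  u * (a * sval s') * (v * (b' * sval t - b * sval t'))); last by ring.
by rewrite e e' !mulr0 addr0.
Qed.

Lemma loc_pi_eq a s b t :
  a * sval t = b * sval s -> loc_pi (a, s) = loc_pi (b, t).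
Proof.
by move=> e; apply/loc_piP; exists 1; rewrite ?rpred1 //= e subrr mulr0.
Qed.

Let locP x : exists a s, x = loc_pi (a, s).
Proof.
by case e : (loc_repr x) => [a s]; exists a, s; rewrite -e loc_reprK.
Qed.

Fact loc_addA : associative loc_add.
Proof.
move=> x y z; have [a [s ->]] := locP x; have [b [t ->]] := locP y.
by have [c [r ->]] := locP z; rewrite !loc_add_pi; apply: loc_pi_eq => /=; ring.
Qed.
Fact loc_addC : commutative loc_add.
Proof.
move=> x y; have [a [s ->]] := locP x; have [b [t ->]] := locP y.
by rewrite !loc_add_pi; apply: loc_pi_eq => /=; ring.
Qed.
Fact loc_add0 : left_id (loc_in 0) loc_add.
Proof.
move=> x; have [a [s ->]] := locP x.
by rewrite loc_add_pi; apply: loc_pi_eq => /=; ring.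
Qed.
Fact loc_addN : left_inverse (loc_in 0) loc_opp loc_add.
Proof.
move=> x; have [a [s ->]] := locP x.
by rewrite loc_opp_pi loc_add_pi; apply: loc_pi_eq => /=; ring.
Qed.
Fact loc_mulA : associative loc_mul.
Proof.
move=> x y z; have [a [s ->]] := locP x; have [b [t ->]] := locP y.
by have [c [r ->]] := locP z; rewrite !loc_mul_pi; apply: loc_pi_eq => /=; ring.
Qed.
Fact loc_mulC : commutative loc_mul.
Proof.
move=> x y; have [a [s ->]] := locP x; have [b [t ->]] := locP y.
by rewrite !loc_mul_pi; apply: loc_pi_eq => /=; ring.
Qed.
Fact loc_mul1 : left_id (loc_in 1) loc_mul.
Proof.
move=> x; have [a [s ->]] := locP x.
by rewrite loc_mul_pi; apply: loc_pi_eq => /=; ring.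
Qed.
Fact loc_mulDl : left_distributive loc_mul loc_add.
Proof.
move=> x y z; have [a [s ->]] := locP x; have [b [t ->]] := locP y.
have [c [r ->]] := locP z.
by rewrite !loc_add_pi !loc_mul_pi loc_add_pi; apply: loc_pi_eq => /=; ring.
Qed.

HB.instance Definition _ := GRing.isZmodule.Build localization
  loc_addA loc_addC loc_add0 loc_addN.
HB.instance Definition _ := GRing.Zmodule_isComPzRing.Build localization
  loc_mulA loc_mulC loc_mul1 loc_mulDl.

Fact loc_in_zmod : zmod_morphism loc_in.
Proof.
move=> a b; transitivity (loc_add (loc_in a) (loc_opp (loc_in b))) => //.
rewrite loc_opp_pi loc_add_pi.
by apply: loc_pi_eq => /=; ring.
Qed.
Fact loc_in_monoid : monoid_morphism loc_in.
Proof.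
split=> // a b; transitivity (loc_mul (loc_in a) (loc_in b)) => //.
rewrite loc_mul_pi.
by apply: loc_pi_eq => /=; ring.
Qed.

HB.instance Definition _ :=
  GRing.isZmodMorphism.Build A localization loc_in loc_in_zmod.
HB.instance Definition _ :=
  GRing.isMonoidMorphism.Build A localization loc_in loc_in_monoid.

End Localization.

Definition zerodivisor (A : comPzRingType) (x : A) : Prop :=
  exists2 y : A, y != 0 & x * y = 0.

Definition regular_elt (A : comPzRingType) : {pred A} :=
  fun x => `[< ~ zerodivisor x >].

Fact regular_elt_mulr_closed (A : comPzRingType) :
  mulr_closed (@regular_elt A).
Proof.
split=> [|x y /asboolP xreg /asboolP yreg]; apply/asboolP.
  by move=> [y y0]; rewrite mul1r => e; rewrite e eqxx in y0.
move=> [z z0 e]; apply: xreg; exists (y * z); last by rewrite mulrA.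
by apply/eqP => yz0; apply: yreg; exists z.
Qed.

HB.instance Definition _ (A : comPzRingType) :=
  GRing.isMulClosed.Build A (@regular_elt A) (@regular_elt_mulr_closed A).

Definition total_quotient (A : comPzRingType) : comPzRingType :=
  localization (@regular_elt A).

Definition set_prod (T : comPzRingType) (B C : set T) : set T :=
  [set y | exists n (b c : 'I_n -> T),
     (forall i, B (b i) /\ C (c i)) /\ y = \sum_(i < n) b i * c i].

Section Invertible.
Variables (A : comPzRingType) (J : ideal A).

Let iota : A -> total_quotient A := @loc_in A (@regular_elt A).

Definition ideal_inv : set (total_quotient A) :=
  [set x | forall a, a \in J -> range iota (x * iota a)].

Definition invertible : Prop :=
  set_prod (iota @` [set a | a \in J]) ideal_inv = range iota.

End Invertible.

Section ImageRing.
Variables (A B : comPzRingType) (f : {rmorphism A -> B}).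

Definition in_image : {pred B} := fun y => `[< exists x, f x = y >].

Fact in_image_subring_closed : subring_closed in_image.
Proof.
split=> [|_ _ /asboolP[x <-] /asboolP[y <-]|_ _ /asboolP[x <-] /asboolP[y <-]];
  apply/asboolP; [exists 1|exists (x - y)|exists (x * y)].
- exact: rmorph1.
- exact: rmorphB.
- exact: rmorphM.
Qed.

HB.instance Definition _ :=
  GRing.isSubringClosed.Build B in_image in_image_subring_closed.

Definition image_ring := {y : B | y \in in_image}.

HB.instance Definition _ := SubChoice.on image_ring.
HB.instance Definition _ := GRing.SubChoice_isSubComPzRing.Build B
  (mem in_image) image_ring in_image_subring_closed.

Definition in_image_ideal (I : ideal A) : {pred image_ring^o} :=
  fun y => `[< exists2 x : A, x \in I & f x = val y >].

Fact in_image_ideal_closed (I : ideal A) :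
  subsemimod_closed (in_image_ideal I).
Proof.
split=> [|a y]; first split=> [|y z /asboolP[u Iu eu] /asboolP[v Iv ev]].
- by apply/asboolP; exists 0; [exact: (rpred0 I) | exact: rmorph0].
- apply/asboolP; exists (u + v); first exact: (rpredD Iu Iv).
  by rewrite rmorphD eu ev.
- move=> /asboolP[u Iu eu]; case: a => a ima.
  have /asboolP[x ex] := ima.
  apply/asboolP; exists (x * u).
    by have := @GRing.rpredZ _ _ I x u Iu.
  by rewrite rmorphM ex eu.
Qed.

HB.instance Definition _ (I : ideal A) :=
  GRing.isSubmodClosed.Build image_ring image_ring^o (in_image_ideal I)
    (in_image_ideal_closed I).

Definition image_ideal (I : ideal A) : ideal image_ring := in_image_ideal I.

End ImageRing.

Definition finitely_generated (A : comPzRingType) (I : ideal A) : Prop :=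
  exists n (g : 'I_n -> A), forall x : A,
    x \in I <-> exists c : 'I_n -> A, x = \sum_(i < n) c i * g i.

Definition prime_ideal (A : comPzRingType) (P : ideal A) : Prop :=
  (1 : A) \notin P /\
  forall x y : A, x * y \in P -> x \in P \/ y \in P.

Definition divided (A : comPzRingType) (P : ideal A) : Prop :=
  forall I : ideal A, {subset P <= I} \/ {subset I <= P}.

Section LocalizationAtPrime.
Variables (A : comPzRingType) (P : ideal A) (P_prime : prime_ideal P).

Definition prime_compl (_ : prime_ideal P) : {pred A} := fun x => x \notin P.

Fact prime_compl_mulr_closed : mulr_closed (prime_compl P_prime).
Proof.
case: (P_prime) => P1 PM; split=> // x y xP yP.
by apply/negP => /PM[]; apply/negP.
Qed.

HB.instance Definition _ :=
  GRing.isMulClosed.Build A (prime_compl P_prime) prime_compl_mulr_closed.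

Definition localization_at : comPzRingType :=
  localization (prime_compl P_prime).

End LocalizationAtPrime.

Definition nilpotent (A : comPzRingType) : {pred A^o} :=
  fun x => `[< exists n, x ^+ n = 0 >].

Fact nilpotent_closed (A : comPzRingType) :
  subsemimod_closed (@nilpotent A).
Proof.
split=> [|a x /asboolP[n xn]]; last first.
  by apply/asboolP; exists n; rewrite exprMn xn mulr0.
split=> [|x y /asboolP[m xm] /asboolP[n yn]]; apply/asboolP.
  by exists 1%N; rewrite expr1.
exists (m + n)%N; rewrite exprDn big1 // => i _.
have [ni|/ltnW im] := leqP n i.
  by rewrite -(subnKC ni) exprD yn mul0r mulr0 mul0rn.
by rewrite -addnBA // exprD xm !mul0r mul0rn.
Qed.

HB.instance Definition _ (A : comPzRingType) :=
  GRing.isSubmodClosed.Build A A^o (@nilpotent A) (@nilpotent_closed A).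

Definition nilradical (A : comPzRingType) : ideal A := @nilpotent A.

Definition phi_ring (R : comNzRingType) : Prop :=
  prime_ideal (nilradical R) /\ divided (nilradical R).

Definition strongly_phi_ring (R : comNzRingType) : Prop :=
  phi_ring R /\ forall x : R, zerodivisor x <-> x \in nilradical R.

Definition nonnil (R : comNzRingType) (I : ideal R) : Prop :=
  ~ {subset I <= nilradical R}.

Section Phi.
Variables (R : comNzRingType) (R_phi : phi_ring R).

(* The restriction to R of the map T(R) -> R_Nil(R); only phi(R) and the
   phi(I) are ever used. *)
Definition phi : {rmorphism R -> localization_at R_phi.1} :=
  @loc_in R (prime_compl R_phi.1).

Definition phi_invertible (I : ideal R) : Prop :=
  invertible (image_ideal phi I).

Definition phi_Prufer : Prop :=
  forall I : ideal R, finitely_generated I -> nonnil I -> phi_invertible I.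

End Phi.

Definition phi_wgldim (R : comNzRingType) : enat :=
  enat_sup [set e | exists2 I : ideal R, nonnil I & e = flat_dim (quotmod I)].

Definition nonnil_semihereditary (R : comNzRingType) : Prop :=
  forall I : ideal R, finitely_generated I -> nonnil I ->
    projective (submodule I).

(* Main.v *)
Require Import Defs.
From HB Require Import structures.
From mathcomp Require Import all_boot all_order all_algebra.
From mathcomp Require Import boolp classical_sets.
From mathcomp Require Import ring.

(** All three conditions are compared with a fourth one: every element outside
    Nil(R) is regular, and I (aR : I) = aR for every finitely generated ideal I
    and every a in I outside Nil(R). The second half says that I divides a
    principal ideal generated by a regular element, which is invertibility
    without fractions.

    The Pruefer condition. When the elements outside Nil(R) are regular, phi is
    injective, so that phi(R) is a copy of R and invertibility of phi(I) can be
    read in R: an element c of (aR : I) corresponds to the fraction c/a in the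
    inverse of I. Regularity of the elements outside Nil(R) is itself equivalent
    to Z(R) = Nil(R).

    The projectivity condition. A dual basis (h_i, g_i) of a projective ideal I
    gives a = sum of h_i(a) g_i, and h_i(a) y = a h_i(y) puts h_i(a) in (aR :
    I). Conversely, if a = sum of c_i x_i is regular, then y |-> c_i y / a and
    x_i form a dual basis. For I = aR the dual basis has the form a = h(a) a
    with h(a) z = h(za) = 0 as soon as az = 0; since Nil(R) is prime, 1 - h(a)
    is then nilpotent, whence z = 0 ([nonnil_cancel]).

    From the fourth condition to flat dimension at most 1. Any finite set of
    elements of a nonnil ideal I lies in a finitely generated nonnil ideal
    contained in I, which has a dual basis. That is enough for I to be flat
    ([locally_dual_basis_flat]), and 0 -> I -> R -> R/I is a flat resolution.

    From flat dimension at most 1 to the fourth condition. This is the delicate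
    part. The only consequence of a flat resolution 0 -> F1 -> F0 -> R/I that is
    needed is: if a (x) u = 0 in I (x) N, then a lies in Ann(u) I
    ([two_term_flat_resolution_annihilator]). Flatness of F1 and flatness of F0
    are each applied to a single tensor, so that Tor and the flatness of I are
    bypassed. With I = aR, N = R and u = z such that az = 0, one gets a = fa
    with fz = 0, and regularity follows as above. With I generated by g_1, ...,
    g_n, with N = R^n / aR^n and u the class of (g_1, ..., g_n), one has a (x) u
    = 0 because the g_i can be moved to the left, and Ann(u) = (aR : I); hence a
    lies in I (aR : I). *)

Set Implicit Arguments.
Unset Strict Implicit.
Unset Printing Implicit Defensive.

Import GRing.Theory.

Local Open Scope ring_scope.
Local Open Scope quotient_scope.

(** * Submodules and quotient modules *)

Section Submodules.
Variable A : comPzRingType.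

Section Span.
Variables (V : lmodType A) (n : nat) (g : 'I_n -> V).

Definition in_spanmod : {pred V} :=
  fun x => `[< exists c : 'I_n -> A, x = \sum_i c i *: g i >].

Fact in_spanmod_closed : subsemimod_closed in_spanmod.
Proof.
split=> [|a x /asboolP[c ->]]; last first.
  apply/asboolP; exists (fun i => a * c i); rewrite scaler_sumr.
  by apply: eq_bigr => i _; rewrite scalerA.
split=> [|x y /asboolP[c ->] /asboolP[d ->]]; apply/asboolP.
  by exists (fun=> 0); rewrite big1 // => i _; rewrite scale0r.
exists (fun i => c i + d i); rewrite -big_split /=.
by apply: eq_bigr => i _; rewrite scalerDl.
Qed.

HB.instance Definition _ := GRing.isSubmodClosed.Build A V in_spanmod in_spanmod_closed.

Definition spanmod : submodClosed V := in_spanmod.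

Lemma spanmodP x : reflect (exists c : 'I_n -> A, x = \sum_i c i *: g i) (x \in spanmod).
Proof. exact: asboolP. Qed.

Lemma mem_spanmod i : g i \in spanmod.
Proof.
apply/spanmodP; exists (fun j => (j == i)%:R); rewrite (bigD1 i) //= eqxx scale1r.
by rewrite big1 ?addr0 // => j /negPf->; rewrite scale0r.
Qed.

Lemma spanmod_sub (W : submodClosed V) : (forall i, g i \in W) -> {subset spanmod <= W}.
Proof.
by move=> gW x /spanmodP[c ->]; apply: rpred_sum => i _; apply: rpredZ.
Qed.

End Span.

Definition cyclicmod (V : lmodType A) (u : V) : submodClosed V := spanmod (fun _ : 'I_1 => u).

Lemma cyclicmodP (V : lmodType A) (u x : V) :
  reflect (exists r, x = r *: u) (x \in cyclicmod u).
Proof.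
apply: (iffP (spanmodP _ _)) => [[c ->]|[r ->]].
  by exists (c ord0); rewrite big_ord1.
by exists (fun=> r); rewrite big_ord1.
Qed.

Lemma mem_cyclicmod (V : lmodType A) (u : V) : u \in cyclicmod u.
Proof. exact: (mem_spanmod _ ord0). Qed.

Lemma spanmod_fg n (g : 'I_n -> A^o) : finitely_generated (spanmod g).
Proof.
exists n, g => x; split=> [/spanmodP[c ->]|[c ->]]; first by exists c.
by apply/spanmodP; exists c.
Qed.

Section Annihilator.
Variables (V : lmodType A) (u : V).

Definition in_annihilator : {pred A^o} := fun c => (c : A) *: u == 0.

Fact in_annihilator_closed : subsemimod_closed in_annihilator.
Proof.
split=> [|a x /eqP xu]; last by apply/eqP; rewrite -scalerA xu scaler0.
split=> [|x y /eqP xu /eqP yu]; apply/eqP; first exact: scale0r.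
by rewrite scalerDl xu yu addr0.
Qed.

HB.instance Definition _ :=
  GRing.isSubmodClosed.Build A A^o in_annihilator in_annihilator_closed.

Definition annihilator : ideal A := in_annihilator.

Lemma annihilatorP (c : A) : reflect (c *: u = 0) (c \in annihilator).
Proof. exact: eqP. Qed.

End Annihilator.

Section Scaled.
Variables (V : lmodType A) (a : A).

Definition in_scaled : {pred V} := fun x => `[< exists y, x = a *: y >].

Fact in_scaled_closed : subsemimod_closed in_scaled.
Proof.
split=> [|b x /asboolP[y ->]]; last first.
  by apply/asboolP; exists (b *: y); rewrite !scalerA mulrC.
split=> [|x y /asboolP[v ->] /asboolP[w ->]]; apply/asboolP.
  by exists 0; rewrite scaler0.
by exists (v + w); rewrite scalerDr.
Qed.

HB.instance Definition _ :=
  GRing.isSubmodClosed.Build A V in_scaled in_scaled_closed.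

(** The submodule aV; the values a = 1 and a = 0 also serve as the whole module
    and as the zero submodule. *)
Definition scaled : submodClosed V := in_scaled.

Lemma scaledP x : reflect (exists y, x = a *: y) (x \in scaled).
Proof. exact: asboolP. Qed.

End Scaled.

Lemma mem_scaled1 (V : lmodType A) (x : V) : x \in scaled V 1.
Proof. by apply/scaledP; exists x; rewrite scale1r. Qed.

Lemma scaled0P (V : lmodType A) (x : V) : x \in scaled V 0 -> x = 0.
Proof. by case/scaledP => y ->; rewrite scale0r. Qed.

Section IdealProduct.
Variables (V : lmodType A) (C : ideal A) (W : submodClosed V).

Definition in_ideal_prod : {pred V} := fun x => `[< exists n (c : 'I_n -> A) (w : 'I_n -> V),
  [/\ forall i, c i \in C, forall i, w i \in W & x = \sum_i c i *: w i] >].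

Fact in_ideal_prod_closed : subsemimod_closed in_ideal_prod.
Proof.
split=> [|a x /asboolP[n [c [w [cC wW ->]]]]]; last first.
  apply/asboolP; exists n, c, (fun i => a *: w i); split=> // [i|].
    exact: rpredZ.
  by rewrite scaler_sumr; apply: eq_bigr => i _; rewrite !scalerA mulrC.
split=> [|x y /asboolP[n [c [w [cC wW ->]]]] /asboolP[m [d [v [dC vW ->]]]]].
  apply/asboolP; exists 0%N, (fun=> 0), (fun=> 0).
  by split=> [i|i|]; rewrite ?big_ord0 //; apply: rpred0.
apply/asboolP; exists (n + m)%N.
exists (fun i => match split i with inl j => c j | inr j => d j end).
exists (fun i => match split i with inl j => w j | inr j => v j end).
split=> [i|i|]; [by case: split..|].
rewrite big_split_ord /=; congr (_ + _); apply: eq_bigr => i _.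
  by rewrite (unsplitK (inl i)).
by rewrite (unsplitK (inr i)).
Qed.

HB.instance Definition _ :=
  GRing.isSubmodClosed.Build A V in_ideal_prod in_ideal_prod_closed.

Definition ideal_prod : submodClosed V := in_ideal_prod.

Lemma ideal_prodP x : reflect (exists n (c : 'I_n -> A) (w : 'I_n -> V),
    [/\ forall i, c i \in C, forall i, w i \in W & x = \sum_i c i *: w i])
  (x \in ideal_prod).
Proof. exact: asboolP. Qed.

Lemma mem_ideal_prod (c : A) w : c \in C -> w \in W -> c *: w \in ideal_prod.
Proof.
move=> cC wW; apply/ideal_prodP; exists 1%N, (fun=> c), (fun=> w).
by rewrite big_ord1.
Qed.

End IdealProduct.

Section QuotientMap.
Variables (V : lmodType A) (W : submodClosed V).

Let reprP (x : V) :
  x - repr (quotmod_pi W x : {eq_quot @modeq A V W}) \in W.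
Proof. by apply/quotmod_piP; rewrite quotmod_reprK. Qed.

Fact quotmod_pi_linear : linear (quotmod_pi W).
Proof.
pose rp z := repr (quotmod_pi W z : {eq_quot @modeq A V W}).
move=> a x y; transitivity (quotmod_pi W (rp (a *: rp x) + rp y)); last by [].
apply/quotmod_piP; set x' := rp x; set ax' := rp _; set y' := rp y.
have -> : a *: x + y - (ax' + y') =
    a *: (x - x') + (a *: x' - ax') + (y - y').
  by rewrite opprD addrACA scalerBr [in RHS](addrA (_ - _)) subrK.
by apply: rpredD (reprP y); apply: rpredD (reprP _); apply: rpredZ (reprP x).
Qed.

HB.instance Definition _ := GRing.isLinear.Build A V (quotmod W) *:%R
  (quotmod_pi W) quotmod_pi_linear.

Lemma quotmod_pi_surj (x : quotmod W) : exists v, quotmod_pi W v = x.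
Proof. by eexists; apply: quotmod_reprK. Qed.

Lemma quotmod_pi_eq0 (x : V) : quotmod_pi W x = 0 <-> x \in W.
Proof.
rewrite -(raddf0 (quotmod_pi W)); split=> [/quotmod_piP|xW].
  by rewrite subr0.
by apply/quotmod_piP; rewrite subr0.
Qed.

End QuotientMap.
End Submodules.

(** * Tensors and balanced maps *)

Section TensorProducts.
Variables (A : comPzRingType) (M N : lmodType A).
Implicit Types (x : M) (y : N) (s t : seq (M * N)).

Definition tens x y : tensor M N := tens_pi [:: (x, y)].

Lemma tens_pi_cat s t : tens_pi (s ++ t) = tens_pi s + tens_pi t.
Proof. by rewrite -tens_add_pi. Qed.

Lemma tens_pi_sum s : tens_pi s = \sum_(p <- s) tens p.1 p.2.
Proof.
elim: s => [|[x y] s IHs]; first by rewrite big_nil.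
by rewrite big_cons -IHs -tens_pi_cat.
Qed.

Fact tens_is_linear x : linear (tens x).
Proof.
move=> a y y'.
have -> : a *: tens x y = tens x (a *: y).
  by rewrite [LHS]tens_scale_pi; apply/tens_piP/TensZ.
by rewrite -tens_pi_cat; apply/tens_piP/TensDr.
Qed.

HB.instance Definition _ x := GRing.isLinear.Build A N (tensor M N) *:%R
  (tens x) (tens_is_linear x).

Lemma tensZl a x y : tens (a *: x) y = tens x (a *: y).
Proof. exact/tens_piP/TensZ. Qed.

Lemma tensDl x x' y : tens (x + x') y = tens x y + tens x' y.
Proof. by rewrite -tens_pi_cat; apply/tens_piP/TensDl. Qed.

Lemma tens0l y : tens 0 y = 0.
Proof. exact/tens_piP/Tens0. Qed.

Lemma tens_suml I (r : seq I) (F : I -> M) y :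
  tens (\sum_(i <- r) F i) y = \sum_(i <- r) tens (F i) y.
Proof.
by elim/big_rec2: _ => [|i z x _ <-]; rewrite ?tens0l ?tensDl.
Qed.

End TensorProducts.

Section BalancedMaps.
Variables (A : comPzRingType) (M N G : lmodType A).

(** Bilinearity modulo D, for first arguments in J only: the maps to be used are
    built from arbitrary choices of representatives, which are additive only
    modulo D, or are linear only on a submodule J of M. *)
Definition balanced (J : {pred M}) (D : {pred G}) (b : M -> N -> G) : Prop :=
  [/\ forall x x' y, x \in J -> x' \in J -> b (x + x') y - (b x y + b x' y) \in D,
      forall x y y', x \in J -> b x (y + y') - (b x y + b x y') \in D
    & forall a x y, x \in J -> b (a *: x) y - b x (a *: y) \in D].

(** The reason is that a derivation of [tens_rel s t] has finitely many steps:
    L collects the elements of M that it mentions, and every step holds for b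
    modulo D once J contains them. That L is independent of J, D and b is what
    lets J be chosen afterwards, large enough to contain L. *)
Lemma tens_rel_balanced (s t : seq (M * N)) : tens_rel s t ->
  exists L : seq M, forall (J : submodClosed M) (D : submodClosed G) b,
    {subset L <= J} -> balanced J D b ->
    (\sum_(p <- s) b p.1 p.2 : G) - (\sum_(p <- t) b p.1 p.2 : G) \in D.
Proof.
elim=> {s t} [s|s t _ [L IH]|s t u _ [L IH] _ [L' IH']
  |s s' t t' _ [L IH] _ [L' IH']|s t|y|x x' y|x y y'|a x y].
- by exists [::] => J D b _ _; rewrite subrr rpred0.
- exists L => J D b sLJ bb; rewrite -opprB -scaleN1r rpredZ //; exact: IH sLJ bb.
- exists (L ++ L') => J D b sLJ bb.
  rewrite -[X in X - _](subrK (\sum_(p <- t) b p.1 p.2)) -addrA.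
  by rewrite rpredD ?(IH J) ?(IH' J) // => z zL; apply: sLJ; rewrite mem_cat zL ?orbT.
- exists (L ++ L') => J D b sLJ bb; rewrite !big_cat /= opprD addrACA.
  by rewrite rpredD ?(IH J) ?(IH' J) // => z zL; apply: sLJ; rewrite mem_cat zL ?orbT.
- by exists [::] => J D b _ _; rewrite !big_cat /= [X in X - _]addrC subrr rpred0.
- exists [::] => J D b _ [bl _ _]; rewrite big_seq1 big_nil subr0 /=.
  have /(_ (rpred0 J) (rpred0 J)) := bl 0 0 y.
  rewrite addr0 opprD addNKr -scaleN1r => /(rpredZ (-1)).
  by rewrite scalerA mulrNN mulr1 scale1r.
- exists [:: x; x'] => J D b sLJ [bl _ _]; rewrite !big_cons !big_nil /= !addr0.
  by apply: bl; apply: sLJ; rewrite !inE eqxx ?orbT.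
- exists [:: x] => J D b sLJ [_ br _]; rewrite !big_cons !big_nil /= !addr0.
  by apply: br; apply: sLJ; rewrite !inE eqxx.
- exists [:: x] => J D b sLJ [_ _ bZ]; rewrite !big_seq1 /=.
  by apply: bZ; apply: sLJ; rewrite !inE eqxx.
Qed.

Lemma tens_bilinear (b : M -> N -> G) (s : seq (M * N)) :
    (forall y, linear (b ^~ y)) -> (forall x, linear (b x)) ->
    \sum_(p <- s) tens p.1 p.2 = 0 -> \sum_(p <- s) b p.1 p.2 = 0.
Proof.
move=> bl br; rewrite -tens_pi_sum => /tens_piP/tens_rel_balanced[L].
move=> /(_ (scaled M 1) (scaled G 0) b); rewrite big_nil subr0 => sD.
apply: scaled0P; apply: sD => [x _|]; first exact: mem_scaled1.
  have b0y y : b 0 y = 0.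
    by have := bl y (-1) 0 0; rewrite scaler0 addr0 scaleN1r addNr.
  have bx0 x : b x 0 = 0.
    by have := br x (-1) 0 0; rewrite scaler0 addr0 scaleN1r addNr.
  split=> [x x' y _ _|x y y' _|a x y _].
  - by have := bl y 1 x x'; rewrite !scale1r => ->; rewrite subrr rpred0.
  - by have := br x 1 y y'; rewrite !scale1r => ->; rewrite subrr rpred0.
  - have := bl y a x 0; have := br x a y 0; rewrite !addr0 b0y bx0 !addr0.
    by move=> -> ->; rewrite subrr rpred0.
Qed.

End BalancedMaps.

(** * Consequences of flatness *)

Section Flatness.
Variable A : comPzRingType.

Lemma flat_tens_rel (M N : lmodType A) (K : submodClosed N)
    (s : seq (M * submodule K)) :
  flat M -> \sum_(p <- s) tens p.1 (val p.2) = 0 -> tens_rel s [::].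
Proof.
move=> flatM s0; apply/tens_piP.
apply: (flatM _ _ (\val : submodule K -> N) val_inj).
rewrite !tensor_map_pi /= tens_pi_sum big_map s0; exact.
Qed.

(** Flatness makes y (x) u vanish already in M (x) Au, and Au is A/Ann(u); the
    isomorphism of M (x) A/C with M/CM sends y (x) u to the class of y. *)
Lemma flat_tens_eq0 (M N : lmodType A) (y : M) (u : N) :
  flat M -> tens y u = 0 -> y \in ideal_prod (annihilator u) (scaled M 1).
Proof.
move=> flatM yu0; set D := ideal_prod _ _.
pose u' : submodule (cyclicmod u) := exist _ u (mem_cyclicmod u).
have coefP (z : submodule (cyclicmod u)) : exists r, val z = r *: u.
  by apply/cyclicmodP; exact: valP.
pose r z := projT1 (cid (coefP z)).
have rE z : val z = r z *: u := projT2 (cid (coefP z)).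
have annD c x : c *: u = 0 -> c *: x \in D.
  by move=> cu; apply: mem_ideal_prod; [exact/annihilatorP | exact: mem_scaled1].
have /tens_rel_balanced-/(_ M)[L] : tens_rel [:: (y, u')] [::].
  by apply: flat_tens_rel; rewrite ?big_seq1.
move=> /(_ (scaled M 1) D (fun x z => r z *: x)); rewrite big_seq1 big_nil subr0 /=.
move=> ruy; have {}ruy : r u' *: y \in D.
  apply: ruy => [x _|]; first exact: mem_scaled1.
  split=> [x x' z _ _|x z z' _|a x z _].
  - by rewrite scalerDr subrr rpred0.
  - rewrite -scalerDl -scalerBl annD // scalerBl scalerDl -!rE /=.
    exact: subrr.
  - rewrite scalerA -scalerBl annD // scalerBl mulrC -scalerA -!rE /=.
    exact: subrr.
suff : (1 - r u') *: y + r u' *: y \in D by rewrite -scalerDl subrK scale1r.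
apply: (@rpredD _ D _ _ _ ruy).
by apply: annD; rewrite scalerBl -rE scale1r subrr.
Qed.

(** When eps is the identity of V/W, this is the purity of W in V with respect
    to ideals: CV and W meet in CW. By flatness the sum of the x_i (x) c_i
    vanishes in F (x) C, not only in F; it is then sent to CV/CW by y (x) c |->
    c w, where w in V is any lift of eps(y). *)
Lemma flat_quotient_pure (F V : lmodType A) (W : submodClosed V)
    (eps : {linear F -> quotmod W}) (C : ideal A) n
    (c : 'I_n -> A) (x : 'I_n -> F) (v : 'I_n -> V) :
    flat F -> (forall i, c i \in C) -> (forall i, eps (x i) = quotmod_pi W (v i)) ->
  \sum_i c i *: x i = 0 -> \sum_i c i *: v i \in ideal_prod C W.
Proof.
move=> flatF cC epsx cx0; set D := ideal_prod _ _.
pose c' i : submodule C := exist _ (c i : A^o) (cC i).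
have liftP y : exists w, quotmod_pi W w = eps y by exact: quotmod_pi_surj.
pose w y := projT1 (cid (liftP y)).
have wE y : quotmod_pi W (w y) = eps y := projT2 (cid (liftP y)).
have CWD e z : e \in C -> quotmod_pi W z = 0 -> e *: z \in D.
  by move=> eC /quotmod_pi_eq0 zW; apply: mem_ideal_prod.
have /tens_rel_balanced-/(_ V)[L] :
    tens_rel [seq (x i, c' i) | i <- index_enum 'I_n] [::].
  apply: flat_tens_rel => //; rewrite big_map /=.
  rewrite -[RHS](tens0l F (1 : A^o)) -cx0 tens_suml.
  by apply: eq_bigr => i _; rewrite tensZl [_ *: _]mulr1.
move=> /(_ (scaled F 1) D (fun y z => (val z : A) *: w y)).
rewrite big_map big_nil subr0 /= => cw; have {}cw : \sum_i c i *: w (x i) \in D.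
  apply: cw => [y _|]; first exact: mem_scaled1.
  split=> [y y' z _ _|y z z' _|a y z _].
  - rewrite -scalerDr -scalerBr CWD ?(valP z) //.
    by rewrite raddfB raddfD /= !wE raddfD subrr.
  - have -> : \val (z + z') = \val z + \val z' by [].
    by rewrite scalerDl subrr rpred0.
  - have -> : \val (a *: z) = (\val z : A) * a by rewrite mulrC.
    rewrite -scalerA -scalerBr.
    by rewrite CWD ?(valP z) // raddfB /= linearZ /= !wE linearZ subrr.
suff : \sum_i (c i *: v i - c i *: w (x i)) + \sum_i c i *: w (x i) \in D.
  by rewrite sumrB subrK.
apply: (@rpredD _ D _ _ _ cw).
apply: rpred_sum => i _; rewrite -scalerBr; apply: CWD => //.
by rewrite raddfB /= wE epsx subrr.
Qed.

End Flatness.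

Section FlatDimensionOne.
Variables (A : comPzRingType) (I : ideal A) (F0 F1 : lmodType A).
Variables (d : {linear F1 -> F0}) (eps : {linear F0 -> quotmod I}).
Hypotheses (flatF0 : flat F0) (flatF1 : flat F1) (d_inj : injective d).
Hypothesis eps_surj : forall y, exists x, eps x = y.
Hypothesis d_eps_exact : forall x, eps x = 0 <-> exists y, d y = x.

(** Let p in F0 lift 1. The map s : I -> F1 with d(s(r)) = r p is linear, so that
    s(a) (x) u = 0, and flatness of F1 gives s(a) = sum of c_j y_j with the c_j in
    C = Ann(u). Applying d yields the relation a p = sum of c_j d(y_j) in F0 with
    all coefficients in C. Flatness of F0 allows its image in A/I to be lifted to
    A modulo CI, where p lifts to 1 and d(y_j) to 0: a lies in CI. *)
Lemma two_term_flat_resolution_annihilator (N : lmodType A) (u : N) (a : submodule I) :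
  tens a u = 0 -> val a \in ideal_prod (annihilator u) I.
Proof.
move=> au0.
have [p epsp] := eps_surj (quotmod_pi I (1 : A^o)).
have liftP (r : submodule I) : exists y, d y = (val r : A) *: p.
  apply/d_eps_exact; rewrite linearZ /= epsp -linearZ; apply/quotmod_pi_eq0.
  by rewrite [_ *: _]mulr1; exact: valP.
pose s r := projT1 (cid (liftP r)).
have dsE r : d (s r) = (val r : A) *: p := projT2 (cid (liftP r)).
have s_lin : linear s.
  move=> c x y; apply: d_inj; rewrite linearD linearZ /= !dsE scalerA -scalerDl.
  by congr (_ *: _).
have /(flat_tens_eq0 flatF1)/ideal_prodP[n [c [y [cu _ sa]]]] : tens (s a) u = 0.
  have := @tens_bilinear _ _ _ _ (fun (r : submodule I) v => tens (s r) v) [:: (a, u)].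
  rewrite !big_seq1 /=; apply=> // [v|r]; last exact: linearP.
  by move=> e r r'; rewrite s_lin tensDl tensZl linearZ.
have auN : (val a : A) *: u = 0.
  have := @tens_bilinear _ _ _ _ (fun (r : submodule I) v => (val r : A) *: v) [:: (a, u)].
  rewrite !big_seq1 /=; apply=> // [v|r] e x1 x2.
    have -> : \val (e *: x1 + x2) = e * (\val x1 : A) + \val x2 by [].
    by rewrite scalerDl scalerA.
  by rewrite scalerDr !scalerA mulrC.
(* The relation - a p + sum of c_j d(y_j) = 0, with p at index 0. *)
pose c' (i : 'I_n.+1) : A := if unlift ord0 i is Some j then c j else - (val a : A).
pose x' (i : 'I_n.+1) : F0 := if unlift ord0 i is Some j then d (y j) else p.
pose v' (i : 'I_n.+1) : A^o := if unlift ord0 i is Some j then 0 else 1.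
have := @flat_quotient_pure _ F0 A^o I eps (annihilator u) n.+1 c' x' v' flatF0.
rewrite !big_ord_recl /c' /x' /v' !unlift_none.
under [X in _ + X = 0]eq_bigr do rewrite liftK -linearZ.
under [X in _ + X \in _]eq_bigr do rewrite liftK scaler0.
rewrite big1_eq addr0 -linear_sum -sa dsE scaleNr addNr scaleNr => aI.
have -> : val a = (-1 : A) *: - ((val a : A) *: (1 : A^o)).
  by rewrite scaleN1r opprK [_ *: _]mulr1.
apply: rpredZ; apply: aI => // i; case: (unliftP ord0 i) => [j|] _ //.
- by apply/annihilatorP; rewrite scaleNr auN oppr0.
- by rewrite raddf0; apply/d_eps_exact; exists (y j).
Qed.

End FlatDimensionOne.

(** * Flat dimension at most one *)

Lemma enat_least_leP (P : nat -> Prop) n :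
  enat_le (enat_least P) (Some n) <-> exists2 m, (m <= n)%N & P m.
Proof.
rewrite /enat_least; case: pselect => [ex|nex] /=.
  split=> [le_n|[m le_mn Pm]].
    by exists (ex_minn ex) => //; case: ex_minnP => m /asboolP.
  by case: ex_minnP => k _ /(_ m) kP; apply: leq_trans le_mn; apply/kP/asboolP.
by split=> // -[m _ Pm]; apply: nex; exists m; apply/asboolP.
Qed.

Lemma phi_wgldim_le1P (R : comNzRingType) : enat_le (phi_wgldim R) (Some 1%N) <->
  forall I : ideal R, nonnil I -> exists2 n, (n <= 1)%N & flat_resolution_length (quotmod I) n.
Proof.
split=> [/enat_least_leP[n le_n1 supn] I nonnilI|fdI].
  have : enat_le (flat_dim (quotmod I)) (Some n) by apply: supn; exists I.
  by move=> /enat_least_leP[m le_mn ?]; exists m => //; apply: leq_trans le_n1.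
apply/enat_least_leP; exists 1%N => // _ [I nonnilI ->].
by apply/enat_least_leP; exact: fdI.
Qed.

Lemma flat_resolution_length1_annihilator (A : comPzRingType) (I : ideal A) n
    (N : lmodType A) (u : N) (a : submodule I) :
    (n <= 1)%N -> flat_resolution_length (quotmod I) n ->
  tens a u = 0 -> val a \in ideal_prod (annihilator u) I.
Proof.
move=> le_n1 [F [d [eps [flatF F_gtn eps_surj ex0 ex]]]].
apply: (two_term_flat_resolution_annihilator _ _ _ eps_surj ex0) => //.
move=> x y dxy; apply/eqP; rewrite -subr_eq0; apply/eqP.
have /ex[z <-] : d 0%N (x - y) = 0 by rewrite raddfB /= dxy subrr.
have -> : z = 0 by apply: F_gtn; rewrite ltnS.
exact: raddf0.
Qed.

(** * Flatness from local dual bases *)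

Lemma linear_ex (A : pzRingType) (U V : lmodType A) (f : U -> V) :
  linear f -> exists g : {linear U -> V}, g =1 f.
Proof.
move=> flin; pose fL := GRing.isLinear.Build A U V *:%R f flin.
by exists (HB.pack_for {linear U -> V} f fL).
Qed.

(** Let J contain the elements of M in two tensors and in a proof that their
    images in M (x) N' agree. A dual basis (h_i, g_i) of J rewrites each tensor as
    the sum of the g_i (x) n_i, where n_i is the value on the tensor of
    x (x) y |-> h_i(x) y. The same map evaluated along the proof in M (x) N', whose
    elements of M are all in J, shows that the two elements f(n_i) agree, and f is
    injective. The h_i need not extend linearly to M: those of an invertible ideal
    J inside a larger one multiply by fractions that send J into A. *)
Lemma locally_dual_basis_flat (A : comPzRingType) (M : lmodType A) :
  (forall L : seq M, exists (J : submodClosed M) n (h : 'I_n -> M -> A) (g : 'I_n -> M),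
     [/\ {subset L <= J},
         forall i c x y, x \in J -> y \in J -> h i (c *: x + y) = c * h i x + h i y
       & forall x, x \in J -> x = \sum_i h i x *: g i]) ->
  flat M.
Proof.
move=> dualM N N' f f_inj z1 z2; rewrite -[z1]tens_reprK -[z2]tens_reprK.
move: (tens_repr z1) (tens_repr z2) => s t; rewrite !tensor_map_pi.
move=> /tens_piP/tens_rel_balanced-/(_ N')[L0 L0P].
have [J [n [h [g [sLJ h_lin hg]]]]] := dualM (L0 ++ map fst (s ++ t)).
have expand (r : seq (M * N)) : {subset map fst r <= J} ->
    tens_pi r = \sum_i tens (g i) (\sum_(p <- r) h i p.1 *: p.2).
  move=> rJ; rewrite tens_pi_sum; under [RHS]eq_bigr do rewrite linear_sum.
  rewrite exchange_big /=; apply: eq_big_seq => p pr.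
  rewrite [in LHS](hg p.1) ?rJ ?map_f // tens_suml.
  by apply: eq_bigr => i _; rewrite tensZl.
have sJ : {subset map fst s <= J}.
  by move=> x xs; apply: sLJ; rewrite map_cat !mem_cat xs orbT.
have tJ : {subset map fst t <= J}.
  by move=> x xt; apply: sLJ; rewrite map_cat !mem_cat xt !orbT.
rewrite !expand //; apply: eq_bigr => i _; congr tens; apply: f_inj.
have h0 : h i 0 = 0.
  by have := h_lin i (-1) 0 0; rewrite scaler0 addr0 mulN1r addNr; apply; exact: rpred0.
have hD x y : x \in J -> y \in J -> h i (x + y) = h i x + h i y.
  by move=> xJ yJ; rewrite -[x]scale1r h_lin // mul1r scale1r.
have hZ c x : x \in J -> h i (c *: x) = c * h i x.
  by move=> xJ; rewrite -[_ *: _]addr0 h_lin ?rpred0 // h0 addr0.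
have : (\sum_(p <- [seq (p.1, f p.2) | p <- s]) h i p.1 *: p.2 : N')
    - (\sum_(p <- [seq (p.1, f p.2) | p <- t]) h i p.1 *: p.2 : N') \in scaled N' 0.
  apply: (L0P J (scaled N' 0) (fun x y => h i x *: y)).
    by move=> x xL; apply: sLJ; rewrite mem_cat xL.
  split=> [x x' y xJ x'J|x y y' xJ|a x y xJ].
  - by rewrite hD // scalerDl subrr rpred0.
  - by rewrite scalerDr subrr rpred0.
  - by rewrite hZ // scalerA mulrC subrr rpred0.
rewrite !big_map /= => /scaled0P/eqP; rewrite subr_eq0 => /eqP e.
rewrite !linear_sum; under eq_bigr do rewrite linearZ.
by rewrite e; under [RHS]eq_bigr do rewrite linearZ.
Qed.

Lemma regular_flat (A : comPzRingType) : flat A^o.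
Proof.
apply: locally_dual_basis_flat => L.
exists (scaled A^o 1), 1%N, (fun _ x => x), (fun=> 1); split=> [x _||x _].
- exact: mem_scaled1.
- by [].
- by rewrite big_ord1 [RHS]mulr1.
Qed.

Lemma zero_flat (A : comPzRingType) (M : lmodType A) : (forall x : M, x = 0) -> flat M.
Proof.
move=> M0; apply: locally_dual_basis_flat => L.
exists (scaled M 1), 0%N, (fun _ _ => 0), (fun=> 0); split=> [x _|i|x _].
- exact: mem_scaled1.
- by case: i.
- by rewrite big_ord0; exact: M0.
Qed.

Lemma flat_ideal_resolution (A : comPzRingType) (I : ideal A) :
  flat (submodule I) -> flat_resolution_length (quotmod I) 1.
Proof.
move=> flatI.
pose F i : lmodType A := match i with 0 => A^o | 1 => submodule I | _ => 'rV[A]_0 end.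
pose d i : {linear F i.+1 -> F i} :=
  match i with 0 => (\val : submodule I -> A^o) | _ => \0 end.
have rV0 (x : 'rV[A]_0) : x = 0 by exact: thinmx0.
exists F, d, (quotmod_pi I); split=> [[|[|i]]|[|[|i]] // _|y|x|[|i] x] /=.
- exact: regular_flat.
- exact: flatI.
- exact/zero_flat/rV0.
- exact: quotmod_pi_surj.
- rewrite quotmod_pi_eq0; split=> [xI|[y <-]]; last exact: valP.
  by exists (exist _ x xI).
- split=> [x0|[y <-]]; last by [].
  by exists 0; apply: val_inj; rewrite /= x0.
- by split=> [_|//]; exists 0; case: i x => [|i] x /=; rewrite [x]rV0.
Qed.

Lemma mem_generator (A : comPzRingType) (I : ideal A) n (g : 'I_n -> A) :
    (forall x, x \in I <-> exists c : 'I_n -> A, x = \sum_i c i * g i) ->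
  forall i, g i \in I.
Proof.
move=> gP i; apply/gP; have /spanmodP[c ->] := mem_spanmod (g : 'I_n -> A^o) i.
by exists c.
Qed.

(** * Ideals that divide a principal ideal *)

Section DividesPrincipal.
Variable A : comPzRingType.

(** The element a lies in I (aA : I). When a belongs to I, this means that
    I (aA : I) = aA. *)
Definition divides_principal (I : ideal A) (a : A) : Prop :=
  exists n (c x : 'I_n -> A),
    [/\ forall i, x i \in I,
        forall i y, y \in I -> exists r, c i * y = r * a
      & a = \sum_i c i * x i].

(** The forms are h_i(y) = c_i y / a, since y = sum of (c_i y / a) x_i. *)
Lemma divides_principal_dual_basis (I : ideal A) (a : A) :
    (forall z, a * z = 0 -> z = 0) -> divides_principal I a ->
  exists n (h : 'I_n -> A -> A) (x : 'I_n -> A),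
    [/\ forall i, x i \in I,
        forall i c y z, y \in I -> z \in I -> h i (c * y + z) = c * h i y + h i z
      & forall y, y \in I -> y = \sum_i h i y * x i].
Proof.
move=> a_reg [n [c [x [xI cI aE]]]].
have aI r s : r * a = s * a -> r = s.
  move=> /eqP; rewrite -subr_eq0 -mulrBl mulrC => /eqP/a_reg/eqP.
  by rewrite subr_eq0 => /eqP.
have hP i y : exists r, y \in I -> c i * y = r * a.
  have [/(cI i)[r e]|_] := boolP (y \in I); first by exists r.
  by exists 0.
pose h i y := projT1 (cid (hP i y)).
have hE i y : y \in I -> c i * y = h i y * a := projT2 (cid (hP i y)).
exists n, h, x; split=> // [i b y z yI zI|y yI].
  have byI : b * y \in I by exact: (@rpredZ _ _ I b y yI).
  apply: aI; rewrite -hE; last exact: (@rpredD _ I _ _ byI zI).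
  by rewrite mulrDl -mulrA -!hE // mulrDr mulrCA.
apply: aI; rewrite {1}aE mulr_sumr mulr_suml; apply: eq_bigr => i _.
by rewrite mulrA [y * _]mulrC hE // mulrAC.
Qed.

Lemma regular_divides_projective (I : ideal A) (a : A) :
    (forall z, a * z = 0 -> z = 0) -> divides_principal I a ->
  projective (submodule I).
Proof.
move=> a_reg /(divides_principal_dual_basis a_reg)[n [h [x [xI h_lin hx]]]].
move=> M N p f p_surj.
pose x' i : submodule I := exist _ (x i : A^o) (xI i).
have /fin_all_exists[m mE] i : exists y, p y = f (x' i) by exact: p_surj.
have [//|k kE] := @linear_ex A (submodule I) M (fun y => \sum_i h i (val y) *: m i).
  move=> b y z; rewrite scaler_sumr -big_split; apply: eq_bigr => i _ /=.
  by rewrite [h i _](h_lin i b _ _ (valP y) (valP z)) scalerDl scalerA.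
exists k => y; rewrite kE linear_sum; under eq_bigr do rewrite linearZ /= mE -linearZ.
rewrite -linear_sum; congr (f _); apply: val_inj; rewrite [RHS]hx ?(valP y) //.
by rewrite raddf_sum.
Qed.

(** The h_i are the coordinates of a section of the surjection from A^n onto I
    given by the generators. *)
Lemma fg_projective_dual_basis (I : ideal A) n (g : 'I_n -> A) :
    (forall x, x \in I <-> exists c : 'I_n -> A, x = \sum_i c i * g i) ->
    projective (submodule I) ->
  exists h : 'I_n -> A -> A,
    (forall i y z, y \in I -> h i (z * y) = z * h i y) /\
    forall y, y \in I -> y = \sum_i h i y * g i.
Proof.
move=> gP projI.
pose g' i : submodule I := exist _ (g i : A^o) (mem_generator gP i).
have [p pE] : exists p : {linear 'rV[A]_n -> submodule I},
    p =1 fun v => \sum_i v 0 i *: g' i.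
  apply: linear_ex => b v w; rewrite scaler_sumr -big_split; apply: eq_bigr => i _.
  by rewrite !mxE scalerDl scalerA.
have valsum (e : 'I_n -> A) : val (\sum_i e i *: g' i) = \sum_i e i * g i.
  by rewrite raddf_sum.
have [|h hE] := projI _ _ p (idfun : {linear submodule I -> submodule I}).
  move=> y; have /gP[c e] := valP y; exists (\row_i c i); apply: val_inj.
  by rewrite pE valsum e; apply: eq_bigr => i _; rewrite mxE.
(* Outside I the default value 0 of insubd makes the functions total on A. *)
pose k i (y : A) := h (insubd (0 : submodule I) y) 0 i.
have kE i (y : submodule I) : k i (val y) = h y 0 i by rewrite /k valKd.
exists k; split=> [i y z yI|y yI]; pose y' : submodule I := exist _ (y : A^o) yI.
  have [-> ->] : z * y = val (z *: y') /\ y = val y' by [].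
  by rewrite !kE linearZ mxE.
transitivity (val (p (h y'))); first by rewrite hE.
by rewrite pE valsum; apply: eq_bigr => i _; rewrite -kE.
Qed.

End DividesPrincipal.

Section InvertibleIdeals.
Variable B : comPzRingType.
Let T := total_quotient B.
Let iota : {rmorphism B -> T} := @loc_in B (@regular_elt B).

Lemma total_quotient_in_inj : injective iota.
Proof.
move=> x y /loc_piP[u /asboolP u_reg] /=; rewrite !mulr1 => uxy0.
apply/eqP; rewrite -subr_eq0; apply/negP => xy0; apply: u_reg.
by exists (x - y) => //; apply/negP.
Qed.

Lemma total_quotient_regular_inv (a : B) :
  (forall z, a * z = 0 -> z = 0) -> exists v : T, iota a * v = 1.
Proof.
move=> a_reg.
have aS : a \in @regular_elt B.
  by apply/asboolP => -[y y0 /a_reg ay]; rewrite ay eqxx in y0.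
exists (loc_pi (1, exist _ a aS)).
transitivity (loc_mul (iota a) (loc_pi (1, exist _ a aS))) => //.
by rewrite loc_mul_pi; apply: loc_pi_eq => /=; ring.
Qed.

(** Write 1 = sum of x_i q_i with q_i in the inverse of J; the coefficients are
    c_i = q_i a. *)
Lemma invertible_divides_principal (J : ideal B) (a : B) :
  invertible J -> a \in J -> divides_principal J a.
Proof.
move=> invJ aJ.
have [n [b [q [bq e]]]] : set_prod (iota @` [set y | y \in J])%classic (ideal_inv J) 1.
  by rewrite invJ; exists 1 => //; exact: rmorph1.
have /fin_all_exists[x xP] i : exists x, x \in J /\ iota x = b i.
  by have [[x xJ <-] _] := bq i; exists x.
have qJ i y : y \in J -> exists r, iota r = q i * iota y.
  by move=> yJ; have [_ /(_ y yJ)[r _ er]] := bq i; exists r.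
have /fin_all_exists[c cP] i : exists c, iota c = q i * iota a by exact: qJ.
exists n, c, x; split=> [i|i y yJ|]; first by have [] := xP i.
  have [r rE] := qJ i y yJ; exists r; apply: total_quotient_in_inj.
  by rewrite !rmorphM cP rE mulrAC.
apply: total_quotient_in_inj; rewrite rmorph_sum /= -[LHS]mulr1 e mulr_sumr.
by apply: eq_bigr => i _; rewrite rmorphM cP (xP i).2; ring.
Qed.

(** The fractions c_i / a belong to the inverse of J, and the sum of the
    x_i (c_i / a) is 1. *)
Lemma regular_divides_invertible (J : ideal B) (a : B) :
  (forall z, a * z = 0 -> z = 0) -> divides_principal J a -> invertible J.
Proof.
move=> /total_quotient_regular_inv[v av1] [n [c [x [xJ cJ aE]]]].
apply/seteqP; split=> [_ [m [b [q [bq ->]]]]|_ [t _ <-]].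
  have /fin_all_exists[r rE] i : exists r, iota r = b i * q i.
    have [[y yJ <-] invq] := bq i; have [r _ er] := invq y yJ.
    by exists r; rewrite mulrC.
  by exists (\sum_i r i) => //; rewrite rmorph_sum; apply: eq_bigr.
exists n, (fun i => iota (x i)), (fun i => iota (t * c i) * v); split.
  move=> i; split=> [|y yJ]; first by exists (x i); first exact: xJ.
  have [r er] := cJ i y yJ; exists (t * r) => //.
  have -> : iota (t * c i) * v * iota y = iota (t * (c i * y)) * v.
    by rewrite !rmorphM; ring.
  by rewrite er mulrA [iota (_ * a)]rmorphM -mulrA av1 mulr1.
have -> : \sum_i iota (x i) * (iota (t * c i) * v) = iota t * iota (\sum_i c i * x i) * v.
  rewrite rmorph_sum mulr_sumr mulr_suml; apply: eq_bigr => i _.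
  by rewrite !rmorphM; ring.
by rewrite -aE -mulrA av1 mulr1.
Qed.

End InvertibleIdeals.

(** * Nonnil ideals of a phi-ring *)

Section NonnilFactorization.
Variables (R : comNzRingType) (R_phi : phi_ring R).

Definition nonnil_regular : Prop :=
  forall a : R, a \notin nilradical R -> forall z, a * z = 0 -> z = 0.

Definition fg_divides_nonnil : Prop :=
  forall I : ideal R, finitely_generated I -> forall a : R,
    a \in I -> a \notin nilradical R -> divides_principal I a.

Lemma nonnilP (I : ideal R) : nonnil I <-> exists2 a : R, a \in I & a \notin nilradical R.
Proof.
split=> [nI|[a aI /negP naN] sIN]; last by apply: naN; exact: sIN.
apply: contrapT => nex; apply: nI => a aI; apply/negPn/negP => naN.
by apply: nex; exists a.
Qed.

(** As (1 - f) a = 0 and Nil(R) is prime, 1 - f is nilpotent, while multiplication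
    by 1 - f fixes z. *)
Lemma nonnil_cancel (a f z : R) :
  a \notin nilradical R -> a = f * a -> f * z = 0 -> z = 0.
Proof.
move=> naN af fz.
have : (1 - f) * a \in nilradical R by rewrite mulrBl mul1r -af subrr; exact: rpred0.
case/(R_phi.1.2) => [/asboolP[n f_nil]|]; last by rewrite (negPf naN).
suff <- : (1 - f) ^+ n * z = z by rewrite f_nil mul0r.
by elim: n {f_nil} => [|n IHn]; rewrite ?mul1r // exprS -mulrA IHn mulrBl mul1r fz subr0.
Qed.

(** In aR (x) R one has a (x) z = za (x) 1 = 0, so that a lies in Ann(z) aR. *)
Lemma wgldim1_nonnil_regular : enat_le (phi_wgldim R) (Some 1%N) -> nonnil_regular.
Proof.
move=> /phi_wgldim_le1P fd1 a naN z az0.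
have [|n le_n1 res] := fd1 (cyclicmod (a : R^o)).
  by apply/nonnilP; exists a => //; exact: mem_cyclicmod.
pose a' : submodule (cyclicmod (a : R^o)) := exist _ (a : R^o) (mem_cyclicmod (a : R^o)).
have /(flat_resolution_length1_annihilator le_n1 res) : tens a' (z : R^o) = 0.
  rewrite -[z](mulr1 z) -[z * 1]/(z *: (1 : R^o)) -tensZl.
  suff -> : z *: a' = 0 by exact: tens0l.
  by apply: val_inj; rewrite /= -[RHS]az0 [a * z]mulrC.
case/ideal_prodP => m [c [w [cz wa aE]]].
have /fin_all_exists[r rE] i : exists r, w i = r *: (a : R^o) by exact/cyclicmodP.
apply: (@nonnil_cancel a (\sum_i c i * r i)) => //.
  rewrite mulr_suml [LHS]aE; apply: eq_bigr => i _.
  by rewrite rE scalerA.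
rewrite mulr_suml big1 // => i _; rewrite mulrAC.
by have /annihilatorP := cz i; rewrite -[_ *: _]/(c i * z) => ->; rewrite mul0r.
Qed.

(** The annihilator of the class u of (g_1, ..., g_n) in R^n / aR^n is (aR : I),
    and a (x) u is the sum of the g_i a (x) e_i = g_i (x) a e_i = 0. *)
Lemma wgldim1_fg_divides_nonnil : enat_le (phi_wgldim R) (Some 1%N) -> fg_divides_nonnil.
Proof.
move=> /phi_wgldim_le1P fd1 I [n [g gP]] a aI naN.
have [|k le_k1 res] := fd1 I; first by apply/nonnilP; exists a.
pose a' : submodule I := exist _ (a : R^o) aI.
pose g' i : submodule I := exist _ (g i : R^o) (mem_generator gP i).
pose pi : {linear 'rV[R]_n -> quotmod (scaled 'rV[R]_n a)} := quotmod_pi (scaled 'rV[R]_n a).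
have /(flat_resolution_length1_annihilator le_k1 res) : tens a' (pi (\row_i g i)) = 0.
  rewrite [\row_i _]row_sum_delta !linear_sum big1 // => i _.
  rewrite mxE linearZ /= -tensZl.
  have -> : g i *: a' = a *: g' i by apply: val_inj; exact: mulrC.
  rewrite tensZl -linearZ /= (_ : pi _ = 0) ?linear0 //.
  by apply/quotmod_pi_eq0/scaledP; exists (delta_mx 0 i).
case/ideal_prodP => m [c [x [cg xI aE]]]; exists m, c, x; split=> // i y /gP[e ->].
have /annihilatorP := cg i; rewrite -linearZ => /quotmod_pi_eq0/scaledP[w /rowP cgw].
exists (\sum_j e j * w 0 j); rewrite mulr_sumr mulr_suml; apply: eq_bigr => j _.
by have := cgw j; rewrite !mxE mulrCA => ->; rewrite [a * _]mulrC mulrA.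
Qed.

(** A dual basis of aR gives a = h(a) a, where h(a) z = h(za) = 0. *)
Lemma semihereditary_nonnil_regular : nonnil_semihereditary R -> nonnil_regular.
Proof.
move=> semiR a naN z az0.
have aP (x : R) : x \in cyclicmod (a : R^o) <->
    exists c : 'I_1 -> R, x = \sum_i c i * a.
  by split=> [/spanmodP|c]; last exact/spanmodP.
have [|h [hM hE]] := fg_projective_dual_basis aP.
  apply: semiR; first exact: spanmod_fg.
  by apply/nonnilP; exists a => //; exact: mem_cyclicmod.
have := hE a (mem_cyclicmod (a : R^o)); rewrite big_ord1 => aE.
apply: (nonnil_cancel naN aE); rewrite mulrC -hM ?mem_cyclicmod //.
rewrite mulrC az0 -(mul0r a) hM ?mul0r //; exact: mem_cyclicmod.
Qed.

(** The coefficients are h_i(a), because h_i(a) y = h_i(ay) = a h_i(y). *)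
Lemma semihereditary_fg_divides_nonnil : nonnil_semihereditary R -> fg_divides_nonnil.
Proof.
move=> semiR I fgI a aI naN; have [n [g gP]] := fgI.
have nI : nonnil I by apply/nonnilP; exists a.
have [h [hM hE]] := fg_projective_dual_basis gP (semiR I fgI nI).
exists n, (fun i => h i a), g; split=> [i|i y yI|]; last exact: hE.
  exact: mem_generator gP i.
by exists (h i y); rewrite mulrC -hM // mulrC hM // mulrC.
Qed.

Lemma fg_divides_nonnil_semihereditary :
  nonnil_regular -> fg_divides_nonnil -> nonnil_semihereditary R.
Proof.
move=> reg div I fgI /nonnilP[a aI naN].
exact: (regular_divides_projective (reg a naN) (div I fgI a aI naN)).
Qed.

(** Adjoining a nonnil element a to the finite list L makes the ideal J0 generated
    by the list nonnil, so that J0 has a dual basis, whose vectors lie in I. *)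
Lemma fg_divides_nonnil_wgldim1 :
  nonnil_regular -> fg_divides_nonnil -> enat_le (phi_wgldim R) (Some 1%N).
Proof.
move=> reg div; apply/phi_wgldim_le1P => I /nonnilP[a aI naN].
exists 1%N => //; apply: flat_ideal_resolution; apply: locally_dual_basis_flat => L.
pose a' : submodule I := exist _ (a : R^o) aI.
pose g (i : 'I_(size L).+1) := nth 0 (a' :: L) i.
pose J0 : ideal R := spanmod (fun i => val (g i)).
have sJ0I : {subset J0 <= I} by apply: spanmod_sub => i; exact: valP.
have sJJ0 x : x \in spanmod g -> val x \in J0.
  by move=> /spanmodP[c ->]; rewrite raddf_sum; apply/spanmodP; exists c.
have aJ0 : a \in J0 by exact: mem_spanmod ord0.
have [n [h [x [xJ0 h_lin hx]]]] :=
  divides_principal_dual_basis (reg a naN) (div J0 (spanmod_fg _) a aJ0 naN).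
pose x' i : submodule I := exist _ (x i : R^o) (sJ0I _ (xJ0 i)).
exists (spanmod g), n, (fun i y => h i (val y)), x'; split=> [y yL|i c y z yJ zJ|y yJ].
- have lt_yL : ((index y L).+1 < (size L).+1)%N by rewrite ltnS index_mem.
  have := mem_spanmod g (Ordinal lt_yL); rewrite /g /= nth_index //.
- exact: h_lin (sJJ0 _ yJ) (sJJ0 _ zJ).
- by apply: val_inj; rewrite [LHS]hx ?sJJ0 // raddf_sum.
Qed.

End NonnilFactorization.

(** * The map phi *)

Section PhiEmbedding.
Variables (R : comNzRingType) (R_phi : phi_ring R).
Let phi := phi R_phi.

Lemma nonnil_regular_phi_inj : nonnil_regular R -> injective phi.
Proof.
move=> reg x y /loc_piP[u uN /=]; rewrite !mulr1 => /(reg u uN)/eqP.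
by rewrite subr_eq0 => /eqP.
Qed.

(** Nilpotents are always zerodivisors: if n is least with x^(n+1) = 0, then x^n is
    a nonzero annihilator of x. *)
Lemma strongly_phi_nonnil_regular :
  nonnil_regular R <-> strongly_phi_ring R.
Proof.
split=> [reg|[_ zdN] a naN z az0]; last first.
  have [//|z0] := eqVneq z 0; case/negP: naN; apply/zdN.
  by exists z.
split=> // x; split=> [[y y0 xy0]|/asboolP nil_x].
  by apply/negPn/negP => nxN; rewrite (reg x nxN y xy0) eqxx in y0.
have nil_x' : exists n, x ^+ n == 0 by have [n xn] := nil_x; exists n; apply/eqP.
case: (ex_minnP nil_x') => -[|n] /eqP xn nmin; first by move/eqP: xn; rewrite oner_eq0.
exists (x ^+ n); last by rewrite -exprS.
by apply/negP => /nmin; rewrite ltnn.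
Qed.

Let to_image (x : R) : image_ring phi :=
  exist _ (phi x) (asboolT (ex_intro (fun z => phi z = phi x) x erefl)).

Let to_image_onto (b : image_ring phi) : exists x, to_image x = b.
Proof. by case: b => b bP; have /asboolP[x e] := bP; exists x; apply: val_inj. Qed.

Let to_imageM x y : to_image (x * y) = to_image x * to_image y.
Proof. by apply: val_inj; rewrite /= rmorphM. Qed.

Let to_image_sum n (f : 'I_n -> R) : to_image (\sum_i f i) = \sum_i to_image (f i).
Proof. by apply: val_inj; rewrite raddf_sum -[LHS]/(phi _) rmorph_sum. Qed.

Section Injective.
Hypothesis phi_inj : injective phi.

Let to_image_inj : injective to_image.
Proof. by move=> x y /(congr1 val)/phi_inj. Qed.

Let mem_to_image (I : ideal R) x : (to_image x \in image_ideal phi I) = (x \in I).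
Proof.
apply/asboolP/idP => [[y yI /phi_inj <-] //|xI]; by exists x.
Qed.

Lemma divides_principal_image (I : ideal R) (a : R) :
  divides_principal (image_ideal phi I) (to_image a) <-> divides_principal I a.
Proof.
split=> [[n [c [x [xI cI aE]]]]|[n [c [x [xI cI aE]]]]].
  have /fin_all_exists[c' c'E] i := to_image_onto (c i).
  have /fin_all_exists[x' x'E] i := to_image_onto (x i).
  exists n, c', x'; split=> [i|i y yI|].
  - by rewrite -mem_to_image x'E.
  - have yJ : to_image y \in image_ideal phi I by rewrite mem_to_image.
    have [r] := cI i _ yJ.
    have [r' <-] := to_image_onto r; rewrite -c'E -!to_imageM => /to_image_inj e.
    by exists r'.
  - apply: to_image_inj; rewrite to_image_sum [LHS]aE; apply: eq_bigr => i _.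
    by rewrite to_imageM c'E x'E.
exists n, (to_image \o c), (to_image \o x); split=> [i|i y|] /=.
- by rewrite mem_to_image.
- have [y' <-] := to_image_onto y; rewrite mem_to_image => /(cI i)[r e].
  by exists (to_image r); rewrite -!to_imageM e.
- by rewrite [in LHS]aE to_image_sum; apply: eq_bigr => i _; rewrite to_imageM.
Qed.

End Injective.

Lemma fg_divides_nonnil_phi_Prufer :
  nonnil_regular R -> fg_divides_nonnil R <-> phi_Prufer R_phi.
Proof.
move=> reg; have phi_inj := nonnil_regular_phi_inj reg.
split=> [div I fgI /nonnilP[a aI naN]|pruf I fgI a aI naN].
  apply: (@regular_divides_invertible _ _ (to_image a)); last first.
    by apply/divides_principal_image => //; exact: div.
  move=> b; have [z <-] := to_image_onto b; rewrite -to_imageM => /(congr1 val) /= az0.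
  have -> : z = 0 by apply: (reg a naN); apply: phi_inj; rewrite rmorph0; exact: az0.
  by apply: val_inj; rewrite /= rmorph0.
apply/(divides_principal_image phi_inj)/invertible_divides_principal.
  by apply: pruf => //; apply/nonnilP; exists a.
by apply/asboolP; exists a.
Qed.

End PhiEmbedding.

Theorem theorem2p12 (R : comNzRingType) (R_phi : phi_ring R) :
  ((phi_Prufer R_phi /\ strongly_phi_ring R) <->
     enat_le (phi_wgldim R) (Some 1%N)) /\
  (enat_le (phi_wgldim R) (Some 1%N) <-> nonnil_semihereditary R).
Proof.
split; split.
- case=> pruf /(strongly_phi_nonnil_regular R_phi) reg.
  by apply: fg_divides_nonnil_wgldim1 => //; apply/(fg_divides_nonnil_phi_Prufer R_phi).
- move=> fd1; have reg := wgldim1_nonnil_regular R_phi fd1.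
  split; last exact/strongly_phi_nonnil_regular.
  by apply/fg_divides_nonnil_phi_Prufer => //; exact: wgldim1_fg_divides_nonnil.
- move=> fd1; apply: fg_divides_nonnil_semihereditary.
    exact: wgldim1_nonnil_regular.
  exact: wgldim1_fg_divides_nonnil.
- move=> semiR; apply: fg_divides_nonnil_wgldim1.
    exact: semihereditary_nonnil_regular.
  exact: semihereditary_fg_divides_nonnil.
Qed.
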